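(* Every 4-connected $\{Z_1,K_{1,3}\}$-free graph contains an $H^2$.
   Context: All graphs are finite and simple. $K_{1,3}$ is the claw. $Z_1$ is the graph obtained from $K_{1,3}$ by adding one edge between two of its leaves. A graph is $\{Z_1,K_{1,3}\}$-free if it has no induced subgraph isomorphic to $Z_1$ or $K_{1,3}$. The square of a graph is obtained by adding edges joining all pairs of vertices at distance two. A graph $G$ contains an $H^2$ if $G$ contains, as a subgraph, the square of some hamiltonian cycle of $G$. *)

(* Defs.v *)
From mathcomp Require Import all_boot.

Set Implicit Arguments.
Unset Strict Implicit.
Unset Printing Implicit Defensive.

Record sgraph (T : finType) := SGraph {
  adj :> rel T;
  adj_sym : symmetric adj;
  adj_irr : irreflexive adj }.

Section Constructions.
Variables (T : finType) (G : sgraph T).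

Definition induced_adj (A : {set T}) : rel {x | x \in A} :=
  fun x y => G (val x) (val y).

Fact induced_sym A : symmetric (@induced_adj A).
Proof. by move=> x y; apply: adj_sym. Qed.

Fact induced_irr A : irreflexive (@induced_adj A).
Proof. by move=> x; apply: adj_irr. Qed.

Definition induced (A : {set T}) : sgraph {x | x \in A} :=
  SGraph (@induced_sym A) (@induced_irr A).

Definition add_edge_adj (u v : T) : rel T := fun x y =>
  G x y || [&& u != v & ((x == u) && (y == v)) || ((x == v) && (y == u))].

Fact add_edge_sym u v : symmetric (add_edge_adj u v).
Proof.
by move=> x y; rewrite /add_edge_adj adj_sym orbC [in RHS]orbC;
   congr (_ && _ || _); rewrite orbC andbC [(x == u) && _]andbC.
Qed.

Fact add_edge_irr u v : irreflexive (add_edge_adj u v).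
Proof.
move=> x; rewrite /add_edge_adj adj_irr /= [(x == v) && _]andbC orbb.
by apply/negP=> /and3P[/eqP uv /eqP xu /eqP xv]; apply: uv; rewrite -xu -xv.
Qed.

Definition add_edge (u v : T) : sgraph T :=
  SGraph (add_edge_sym u v) (add_edge_irr u v).

Definition walk (k : nat) (x y : T) : bool :=
  [exists p : k.-tuple T, path G x p && (last x p == y)].

Definition at_distance (k : nat) (x y : T) : bool :=
  walk k x y && [forall j : 'I_k, ~~ walk j x y].

Fact walk_sym k : symmetric (walk k).
Proof.
suff sub x y : walk k x y -> walk k y x by move=> x y; apply/idP/idP; apply: sub.
case/existsP=> p /andP[pp /eqP <-]; apply/existsP.
have sz : size (rev (belast x p)) == k by rewrite size_rev size_belast size_tuple.
exists (Tuple sz) => /=; rewrite rev_path.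
rewrite (eq_path (e' := G)) ?pp /=; last by move=> u v; rewrite /= adj_sym.
by case: (tval p) => //= a s; rewrite rev_cons last_rcons.
Qed.

Fact at_distance_sym k : symmetric (at_distance k).
Proof.
move=> x y; rewrite /at_distance walk_sym; congr (_ && _).
by apply: eq_forallb => j; rewrite walk_sym.
Qed.

Definition square_adj : rel T := fun x y => G x y || at_distance 2 x y.

Fact square_sym : symmetric square_adj.
Proof. by move=> x y; rewrite /square_adj adj_sym at_distance_sym. Qed.

Fact square_irr : irreflexive square_adj.
Proof.
move=> x; rewrite /square_adj adj_irr /=; apply/negP=> /andP[_ /forallP h].
by have /negP := h ord0; apply; apply/existsP; exists [tuple] => /=.
Qed.

Definition square : sgraph T := SGraph square_sym square_irr.

Definition connected : Prop :=
  0 < #|T| /\ forall x y : T, connect G x y.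

End Constructions.

Definition k_connected (k : nat) (T : finType) (G : sgraph T) : Prop :=
  k < #|T| /\ forall S : {set T}, #|S| < k -> connected (induced G (~: S)).

Definition isomorphic (T U : finType) (G : sgraph T) (H : sgraph U) : Prop :=
  exists2 f : T -> U, bijective f & forall x y, H (f x) (f y) = G x y.

Definition induced_free (U : finType) (H : sgraph U)
    (T : finType) (G : sgraph T) : Prop :=
  ~ exists A : {set T}, isomorphic (induced G A) H.

Definition subgraph (T : finType) (H G : sgraph T) : Prop := subrel H G.

Section CompleteBipartite.
Variables m n : nat.

Definition complete_bipartite_adj : rel ('I_m + 'I_n) := fun x y =>
  match x, y with
  | inl _, inr _ | inr _, inl _ => true
  | _, _ => false
  end.

Fact complete_bipartite_sym : symmetric complete_bipartite_adj.
Proof. by case=> ? [?|?]. Qed.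

Fact complete_bipartite_irr : irreflexive complete_bipartite_adj.
Proof. by case. Qed.

Definition complete_bipartite : sgraph ('I_m + 'I_n)%type :=
  SGraph complete_bipartite_sym complete_bipartite_irr.

End CompleteBipartite.

Definition claw := complete_bipartite 1 3.

Definition Z1 := add_edge claw (inr ord0) (inr ord_max).

Section Cycles.
Variable T : finType.

(* [next c x] is the cyclic successor of [x] in [c], and is [x] itself when   *)
(* [x] is not in [c]; hence vertices outside [c] are isolated here.           *)
Definition cycle_adj (c : seq T) : rel T := fun x y =>
  (x != y) && ((next c x == y) || (next c y == x)).

Fact cycle_sym c : symmetric (cycle_adj c).
Proof. by move=> x y; rewrite /cycle_adj eq_sym orbC. Qed.

Fact cycle_irr c : irreflexive (cycle_adj c).
Proof. by move=> x; rewrite /cycle_adj eqxx. Qed.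

Definition cycle_graph (c : seq T) : sgraph T :=
  SGraph (cycle_sym c) (cycle_irr c).

Definition hamiltonian_cycle (G : sgraph T) (c : seq T) : Prop :=
  [/\ 2 < size c, ucycle G c & forall x, x \in c].

Definition contains_H2 (G : sgraph T) : Prop :=
  exists2 c : seq T, hamiltonian_cycle G c & subgraph (square (cycle_graph c)) G.

End Cycles.

(* Main.v *)
(** In a connected paw-free graph every vertex outside a given triangle has at
    least two neighbours in it: a vertex with exactly one would give a paw, and
    the property propagates along edges.  Minimum degree three and
    claw-freeness put every vertex [u] in a triangle [u a b].  Two
    non-neighbours [v], [w] of [u] would then both be adjacent to [a] and [b],
    and [a; u, v, w] would induce a claw or a paw.  So non-adjacency is a
    matching; placing matched vertices at distance [n./2] on a cycle keeps them
    at distance at least three when [n >= 6], and [n = 5] forces [G] to be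
    complete. *)

Require Import Defs.
From mathcomp Require Import all_boot zify.

Set Implicit Arguments.
Unset Strict Implicit.
Unset Printing Implicit Defensive.

(** * Induced copies of the claw and the paw *)

Lemma induced_freeN (U T : finType) (H : sgraph U) (G : sgraph T) (f : U -> T) :
  injective f -> (forall x y, G (f x) (f y) = H x y) -> ~ induced_free H G.
Proof.
move=> f_inj fP; apply; pose A := [set z in codom f].
have fA x : f x \in A by rewrite inE codom_f.
have Af (z : {x | x \in A}) : val z \in codom f by have := valP z; rewrite inE.
have K z : f (iinv (Af z)) = val z by rewrite f_iinv.
exists A, (fun z => iinv (Af z)); last by move=> x y; rewrite -fP !K.
exists (fun x => Sub (f x) (fA x)) => [z|x]; first by apply: val_inj; rewrite /= K.
by apply: f_inj; rewrite K.
Qed.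

Section Star.
Variables (T : finType) (G : sgraph T) (a b c d : T).
Hypotheses (ab : G a b) (ac : G a c) (ad : G a d).
Hypotheses (bc : b != c) (bd : b != d) (cd : c != d).
Hypotheses (nbc : ~~ G b c) (ncd : ~~ G c d).

(** [b] and [d] sit at the leaf positions [ord0] and [ord_max] that [Z1] joins, so one map embeds
    the claw or [Z1], depending on whether [b] and [d] are adjacent. *)
Let star (x : 'I_1 + 'I_3) : T :=
  match x with inl _ => a | inr i => nth a [:: b; c; d] i end.

Let star_inj : injective star.
Proof.
have neq x y : G x y -> x != y by apply: contraTneq => ->; rewrite adj_irr.
have uni : uniq [:: a; b; c; d].
  by rewrite /= !inE !negb_or bc bd cd !neq.
have /andP[a_notin uni3] : (a \notin [:: b; c; d]) && uniq [:: b; c; d] by [].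
have star_mem (i : 'I_3) : nth a [:: b; c; d] i \in [:: b; c; d].
  by rewrite mem_nth.
case=> i [j|j] /= E.
- by rewrite !ord1.
- by case/negP: a_notin; rewrite [X in X \in _]E.
- by case/negP: a_notin; rewrite -[X in X \in _]E.
- congr inr; apply/val_inj/eqP; rewrite -(nth_uniq a _ _ uni3); first exact/eqP.
  all: exact: ltn_ord.
Qed.

Lemma claw_induced : ~~ G b d -> ~ induced_free claw G.
Proof.
move=> nbd; apply: (induced_freeN star_inj).
case=> [i|[[|[|[|//]]] iP]] [j|[[|[|[|//]]] jP]] /=; rewrite ?adj_irr //.
all: by first [done | by rewrite adj_sym | exact/negbTE | by rewrite adj_sym; apply/negbTE].
Qed.

Lemma Z1_induced : G b d -> ~ induced_free Z1 G.
Proof.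
move=> gbd; apply: (induced_freeN star_inj).
case=> [i|[[|[|[|//]]] iP]] [j|[[|[|[|//]]] jP]];
  rewrite /= /add_edge_adj /= ?adj_irr //.
all: by first [done | by rewrite adj_sym | exact/negbTE | by rewrite adj_sym; apply/negbTE].
Qed.

End Star.

(** * Non-adjacency in a 4-connected graph without induced claw or paw *)

Section PawClawFree.
Variables (T : finType) (G : sgraph T).
Hypotheses (connG : k_connected 4 G).
Hypotheses (pawF : induced_free Z1 G) (clawF : induced_free claw G).

Lemma adj_neq x y : G x y -> x != y.
Proof. by apply: contraTneq => ->; rewrite adj_irr. Qed.

Lemma k_connected_connect x y : connect G x y.
Proof.
have [_ /(_ set0)] := connG; rewrite cards0 => /(_ isT) [_ con].
have in0 z : z \in ~: (set0 : {set T}) by rewrite !inE.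
have /connectP[p pP /(congr1 val) /= ->] := con (Sub x (in0 x)) (Sub y (in0 y)).
rewrite -last_map /=; apply/connectP; exists (map val p) => //.
by apply: (homo_path (e := induced G (~: set0))) pP.
Qed.

(** Deleting [S] isolates [x] while [y] survives, so [S] is a vertex cut. *)
Lemma k_connected_cut (S : {set T}) x y :
  x \notin S -> y \notin S -> (forall z, G x z -> z \in S) -> x != y -> 3 < #|S|.
Proof.
move=> xS yS nbrS xy; rewrite ltnNge; apply/negP => lt4.
have [_ /(_ S lt4) [_ con]] := connG.
have xC : x \in ~: S by rewrite inE.
have yC : y \in ~: S by rewrite inE.
have /connectP[[|z p] /= pP] := con (Sub x xC) (Sub y yC).
  by move=> /(congr1 val) /= E; rewrite E eqxx in xy.
case/andP: pP => /nbrS zS; have := valP z; by rewrite inE zS.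
Qed.

Lemma degree_gt3 x : 3 < #|[set y | G x y]|.
Proof.
set N := [set y | G x y]; rewrite ltnNge; apply/negP => le3.
have [n5 _] := connG.
have xN : x \notin N by rewrite inE adj_irr.
have : 0 < #|~: (x |: N)| by have := cardsC (x |: N); rewrite cardsU1 xN; lia.
case/card_gt0P=> y; rewrite !inE negb_or eq_sym => /andP[xy nxy].
suff : 3 < #|N| by lia.
by apply: (k_connected_cut xN _ _ xy); [rewrite inE|move=> z; rewrite inE].
Qed.

Lemma vertex_in_triangle x : exists a b, [/\ G x a, G x b & G a b].
Proof.
have /card_gt2P[a [b [c [[]]]]] := ltnW (degree_gt3 x).
rewrite !inE => xa xb xc [ab bc ca].
have [gab|nab] := boolP (G a b); first by exists a, b.
have [gbc|nbc] := boolP (G b c); first by exists b, c.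
have [gac|nac] := boolP (G a c); first by exists a, c.
by case: (@claw_induced _ G x a b c); rewrite // eq_sym.
Qed.

(** Otherwise the triangle with [v] hanging at [x] is an induced [Z1]. *)
Lemma paw_free_triangle x y z v :
  G x y -> G y z -> G x z -> G v x -> v != y -> v != z -> G v y || G v z.
Proof.
move=> xy yz xz vx vy vz; apply: contraT; rewrite negb_or => /andP[nvy nvz].
case: (@Z1_induced _ G x y v z) => //; try by rewrite adj_sym.
- by rewrite eq_sym.
- exact: adj_neq.
Qed.

Lemma triangle_dominates x y z v :
  G x y -> G y z -> G x z -> v != x -> ~~ G v x -> v != y -> v != z ->
  G v y && G v z.
Proof.
move=> xy yz xz vx nvx vy vz.
(* [hit] also holds on the triangle itself, so the induction along a path can start at [x]; off the
   triangle, [two] raises one neighbour to two. *)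
pose hit v := [|| G v x, G v y | G v z].
have two t : hit t -> t != x -> t != y -> t != z ->
    [|| G t x && G t y, G t y && G t z | G t x && G t z].
  move=> ht tx ty tz.
  have yx : G y x by rewrite adj_sym.
  have zy : G z y by rewrite adj_sym.
  have zx : G z x by rewrite adj_sym.
  case/or3P: ht => g; [have := paw_free_triangle xy yz xz g ty tz
    | have := paw_free_triangle yx xz yz g tx tz
    | have := paw_free_triangle zx xy zy g tx ty];
    by case/orP=> g'; rewrite g g' ?orbT.
have hitP : hit v.
  have /connectP[p] := k_connected_connect x v.
  have : hit x by rewrite /hit xy orbT.
  elim: p (x) => [|w p IH] u hu /=; first by move=> _ ->.
  case/andP=> uw; apply: IH.
  have wu : G w u by rewrite adj_sym.
  have [->|wx] := eqVneq w x; first by rewrite /hit xy orbT.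
  have [->|wy] := eqVneq w y; first by rewrite /hit yz !orbT.
  have [->|wz] := eqVneq w z; first by rewrite /hit adj_sym xz.
  have [ux|ux] := eqVneq u x; first by rewrite /hit -ux wu.
  have [uy|uy] := eqVneq u y; first by rewrite /hit -uy wu orbT.
  have [uz|uz] := eqVneq u z; first by rewrite /hit -uz wu !orbT.
  (* Two triangle vertices adjacent to [u] form a second triangle with [u]; as [w] is adjacent to
     [u], it must see one of those two. *)
  rewrite /hit; case/or3P: (two u hu ux uy uz) => /andP[g1 g2].
  - by rewrite orbA (@paw_free_triangle u x y w).
  - by rewrite (@paw_free_triangle u y z w) ?orbT.
  - by rewrite orbCA (@paw_free_triangle u x z w) ?orbT.
by move: (two v hitP vx vy vz); rewrite (negbTE nvx) /= orbF.
Qed.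

Lemma nonadj_unique u v w :
  u != v -> u != w -> ~~ G u v -> ~~ G u w -> v = w.
Proof.
move=> uv uw nuv nuw; apply/eqP; apply: contraT => vw.
have [a [b [ua ub ab]]] := vertex_in_triangle u.
have dom t : u != t -> ~~ G u t -> G a t.
  move=> ut nut; have := @triangle_dominates u a b t ua ab ub.
  rewrite eq_sym ut [G t u]adj_sym nut [G a t]adj_sym => /(_ isT isT).
  have -> : t != a by apply: contraNneq nut => ->.
  have -> : t != b by apply: contraNneq nut => ->.
  by case/(_ isT isT)/andP.
have [av aw] := (dom v uv nuv, dom w uw nuw).
have au : G a u by rewrite adj_sym.
have [gvw|nvw] := boolP (G v w).
- case: (@Z1_induced _ G a v u w); rewrite ?[v == u]eq_sym //.
  by rewrite adj_sym.
- by case: (@claw_induced _ G a u v w).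
Qed.

(** The vertices other than [x] and [y] separate them, so there are at least four. This excludes
    order five, where antipodal vertices are only two apart. *)
Lemma nonadj_card x y : x != y -> ~~ G x y -> 5 < #|T|.
Proof.
move=> xy nxy; have : 3 < #|~: [set x; y]|.
  apply: (@k_connected_cut _ x y) => //; rewrite ?inE ?eqxx ?orbT // => z xz.
  rewrite !inE negb_or [z == x]eq_sym adj_neq //=.
  by apply: contraNneq nxy => <-.
by have := cardsC [set x; y]; rewrite cards2 xy; lia.
Qed.

End PawClawFree.

(** * Cyclic orders and squares of hamiltonian cycles *)

Lemma involution_antipodal (T : finType) (m : T -> T) : involutive m ->
  exists c : seq T, [/\ uniq c, forall x, x \in c & forall x, m x != x ->
    index (m x) c = index x c + #|T|./2 \/ index x c = index (m x) c + #|T|./2].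
Proof.
move=> mK; have m_inj := inv_inj mK.
(* [enum_rank] selects one element of each swapped pair for [p]; [q] lists the partners in the same
   order, and [r] the fixed points. *)
pose p := [seq x <- enum T | enum_rank x < enum_rank (m x)].
pose r := [seq x <- enum T | m x == x].
pose q := map m p; pose h := #|T|./2; pose k := h - size p.
have pE x : (x \in p) = (enum_rank x < enum_rank (m x)).
  by rewrite mem_filter mem_enum andbT.
have rE x : (x \in r) = (m x == x) by rewrite mem_filter mem_enum andbT.
have qE x : (x \in q) = (enum_rank (m x) < enum_rank x).
  by rewrite -{1}[x]mK mem_map // pE mK.
have rank_eq x : (enum_rank x == enum_rank (m x) :> nat) = (m x == x).
  by rewrite val_eqE (inj_eq enum_rank_inj) eq_sym.
pose c0 := p ++ q ++ r.
have c0_uniq : uniq c0.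
  have p_uniq : uniq p by apply/filter_uniq/enum_uniq.
  have r_uniq : uniq r by apply/filter_uniq/enum_uniq.
  rewrite !cat_uniq map_inj_uniq // p_uniq r_uniq /= andbT.
  rewrite has_cat negb_or -andbA; apply/and3P; split; apply/hasPn => x.
  - by rewrite qE pE -leqNgt => /ltnW.
  - by rewrite rE pE => /eqP ->; rewrite ltnn.
  - by rewrite rE qE => /eqP ->; rewrite ltnn.
have c0_mem x : x \in c0.
  by rewrite !mem_cat pE qE rE -rank_eq; case: ltngtP.
have szT : size p + (size p + size r) = #|T|.
  rewrite -[size p in X in _ + X](size_map m) -!size_cat -/q -/c0 cardT.
  apply/perm_size/uniq_perm => //; first exact: enum_uniq.
  by move=> x; rewrite c0_mem mem_enum.
(* [k] fixed points pad [p] to length [h], so each pair of [p] and [q] is [h] apart. *)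
pose c := (p ++ take k r) ++ q ++ drop k r.
have perm_c : perm_eq c c0.
  by rewrite /c /c0 -catA perm_cat2l perm_catCA cat_take_drop.
(* By [szT], [k] is half of [size r] rounded down: the subtraction in [k] does not truncate, and [r]
   is long enough for [take k]. *)
have sz_half : size (p ++ take k r) = h.
  by rewrite size_cat size_takel /k /h; lia.
have index_q x : x \in p -> index (m x) c = index x c + h.
  move=> xp; have rkx : enum_rank x < enum_rank (m x) by rewrite -pE.
  have nmxp : m x \notin p by rewrite pE mK -leqNgt ltnW.
  have nmxr : m x \notin take k r.
    apply: contraL rkx => /mem_take; rewrite rE mK => /eqP xm.
    by rewrite -xm ltnn.
  rewrite /c index_cat sz_half mem_cat (negbTE nmxp) (negbTE nmxr) /=.
  by rewrite !index_cat mem_cat (map_f m xp) xp /= index_map // addnC.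
exists c; split; first by rewrite (perm_uniq perm_c).
  by move=> x; rewrite (perm_mem perm_c).
move=> x; rewrite -rank_eq neq_ltn => /orP[xp|mxp]; first by left; apply: index_q; rewrite pE.
by right; rewrite -{1}[x]mK index_q // pE mK.
Qed.

Lemma index_next (T : eqType) (c : seq T) x : uniq c -> x \in c ->
  index (next c x) c = (index x c).+1 %% size c.
Proof.
case: c => // y c uc xc; rewrite next_nth xc.
have ix : index x (y :: c) <= size c by rewrite -ltnS -[(size c).+1]/(size (y :: c)) index_mem.
have [lt|ge] := ltnP (index x (y :: c)) (size c).
  by rewrite -[nth y c _]/(nth y (y :: c) _.+1) index_uniq ?modn_small.
(* For the last entry, [nth] falls back on its default, the head [y], which is the wrap to index
   0. *)
have -> : index x (y :: c) = size c by apply/eqP; rewrite eqn_leq ix.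
by rewrite nth_default // index_head modnn.
Qed.

(** Two cycle steps in opposite directions return to their start, since [next c] is injective; hence
    vertices at distance two are joined by two steps in the same direction. *)
Lemma contains_H2_next (T : finType) (G : sgraph T) (c : seq T) :
  2 < size c -> uniq c -> (forall x, x \in c) ->
  (forall x, G x (next c x)) -> (forall x, G x (next c (next c x))) ->
  contains_H2 G.
Proof.
move=> c3 uc cT g1 g2; exists c.
  split=> //; apply/andP; split=> //.
  by apply: sub_cycle (cycle_next uc) => x y /eqP <-.
move=> x y /orP[/andP[_ /orP[/eqP <-|/eqP <-]]|/andP[]]; rewrite 1?[G (next c y) y]adj_sym //.
case/existsP=> -[[|z [|t []]] //= _] /andP[/and3P[xz zt _] /eqP <-] /forallP /(_ ord0) n0.
have {n0} xt : x != t.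
  by apply: contra n0 => xt; apply/existsP; exists [tuple].
have next_inj := can_inj (prev_next uc).
case/andP: xz => _ /orP[]/eqP xz; case/andP: zt => _ /orP[]/eqP zt.
- by rewrite -zt -xz.
- by move: xt; rewrite -(inj_eq next_inj) xz zt eqxx.
- by move: xt; rewrite -xz -zt eqxx.
- by rewrite adj_sym -xz -zt.
Qed.

Theorem theorem4 (T : finType) (G : sgraph T) :
  k_connected 4 G -> induced_free Z1 G -> induced_free claw G -> contains_H2 G.
Proof.
move=> connG pawF clawF.
have nonadj_uniq := nonadj_unique connG pawF clawF.
(* The default [x] makes vertices adjacent to all others fixed points, so that [m] is an
   involution. *)
pose m x := odflt x [pick y | (x != y) && ~~ G x y].
have mP x y : x != y -> ~~ G x y -> m x = y.
  move=> xy nxy; rewrite /m; case: pickP => [z /andP[xz nxz]|/(_ y)].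
    exact: (nonadj_uniq x).
  by rewrite xy nxy.
have mK : involutive m.
  move=> x; have [y /andP[xy nxy]|none] := pickP [pred y | (x != y) && ~~ G x y].
    by rewrite (mP x y) // (mP y x) // 1?eq_sym // adj_sym.
  have mx : m x = x by rewrite /m; case: pickP => // y; have /= -> := none y.
  by rewrite !mx.
have [c [uc cT cP]] := involution_antipodal mK.
have szc : size c = #|T|.
  by rewrite cardT; apply/perm_size/uniq_perm; rewrite ?enum_uniq // => x; rewrite cT mem_enum.
have [n5 _] := connG.
have adj_index x y :
    index y c = (index x c).+1 %% #|T| \/ index y c = (index x c).+2 %% #|T| -> G x y.
  move=> iy; have ix : index x c < #|T| by rewrite -szc index_mem.
  (* Below twice the length, reduction modulo [#|T|] removes at most one full turn, which leaves
     linear equations. *)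
  have wrap j : j < #|T|.*2 -> j %% #|T| = j \/ j %% #|T| + #|T| = j.
    move=> lt; have [l|l] := ltnP j #|T|; first by left; rewrite modn_small.
    by right; rewrite -{1}(subnK l) modnDr modn_small ?subnK //; lia.
  have {}iy : (index y c = (index x c).+1 \/ index y c + #|T| = (index x c).+1)
      \/ (index y c = (index x c).+2 \/ index y c + #|T| = (index x c).+2).
    by case: iy => ->; [left|right]; apply: wrap; lia.
  have xy : x != y by apply/eqP => xy; rewrite -{}xy in iy; lia.
  apply: contraT => nxy; have n6 := nonadj_card connG xy nxy.
  (* For order at least six, [#|T|./2] lies between 3 and [#|T| - 3], so the index gap of partners
     cannot be one or two steps, wrapped or not. *)
  have half : #|T| = odd #|T| + #|T|./2.*2 by rewrite odd_double_half.
  have := cP x; rewrite (mP x y xy nxy) eq_sym => /(_ xy).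
  by case: (odd _) half iy => half []; lia.
apply: (@contains_H2_next _ _ c) => // [|x|x]; first by rewrite szc; lia.
- by apply: adj_index; left; rewrite index_next // szc.
- by apply: adj_index; right; rewrite !index_next // szc -addn1 modnDml addn1.
Qed.
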